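(* Let $c>0$ and let $(p,u,v)$, with $p,u,v:\mathbb{R}^2\times[0,\infty)\to\mathbb{R}$ of class $C^3$, be a solution of the two-dimensional acoustic equations $$\partial_t p + c(\partial_x u+\partial_y v)=0,\qquad \partial_t u + c\,\partial_x p=0,\qquad \partial_t v + c\,\partial_y p = 0 .$$ Fix $(x,y)\in\mathbb{R}^2$, $t\ge 0$ and $\nu\in[0,1]$. For $\Delta t>0$ put $P=(x,y,t+\Delta t)$, $P'=(x,y,t)$, and for $R\ge 0$ put $\mathbf{Q}_R(\theta)=(x+R\cos\theta,\;y+R\sin\theta,\;t)$, $\theta\in[0,2\pi]$, and $\mathbf{Q}(\theta)=\mathbf{Q}_{c\Delta t}(\theta)$. Then, as $\Delta t\to0$, $$\begin{aligned}u(P)=&\ \frac1\pi\int_0^{2\pi}\Big(-p(\mathbf{Q}(\theta))\cos\theta+u(\mathbf{Q}(\theta))\big(2\cos^2\theta-\tfrac12\big)+2v(\mathbf{Q}(\theta))\sin\theta\cos\theta\Big)d\theta\\&-\left(u(P')-\frac13\left(\frac4{2\pi}\int_0^{2\pi}u\big(\mathbf{Q}_{\frac{\nu}{2}c\Delta t}(\theta)\big)d\theta-\frac1{2\pi}\int_0^{2\pi}u\big(\mathbf{Q}_{\nu c\Delta t}(\theta)\big)d\theta\right)\right)+\mathcal{O}(\Delta t^3),\end{aligned}$$ $$\begin{aligned}v(P)=&\ \frac1\pi\int_0^{2\pi}\Big(-p(\mathbf{Q}(\theta))\sin\theta+2u(\mathbf{Q}(\theta))\sin\theta\cos\theta+v(\mathbf{Q}(\theta))\big(2\sin^2\theta-\tfrac12\big)\Big)d\theta\\&-\left(v(P')-\frac13\left(\frac4{2\pi}\int_0^{2\pi}v\big(\mathbf{Q}_{\frac{\nu}{2}c\Delta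 t}(\theta)\big)d\theta-\frac1{2\pi}\int_0^{2\pi}v\big(\mathbf{Q}_{\nu c\Delta t}(\theta)\big)d\theta\right)\right)+\mathcal{O}(\Delta t^3).\end{aligned}$$
   Context: Here $p$ is the pressure, $(u,v)$ the velocity and $c$ the constant speed of sound. These formulas (without the error terms) are the velocity updates of the approximate evolution operator called $\mathrm{EG2}_{\delta,\nu}$. The notation $\mathcal{O}(\Delta t^3)$ means a quantity bounded by $K\Delta t^3$ for all sufficiently small $\Delta t>0$, where $K$ may depend on the solution, on $c$, on $\nu$ and on the fixed point $(x,y,t)$. *)

(* Defs.v *)
From Stdlib Require Import Reals.
From Coquelicot Require Import Coquelicot.
Open Scope R_scope.

(** A field on R^2 x [0,oo) is a total function of (x, y, t); its values at
    t < 0 never occur in the definitions below. *)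
Definition half_space (q : R * R * R) : Prop := 0 <= snd q.

Definition is_dx (f fx : R * R * R -> R) : Prop :=
  forall x y t, 0 <= t -> is_derive (fun s => f (s, y, t)) x (fx (x, y, t)).

Definition is_dy (f fy : R * R * R -> R) : Prop :=
  forall x y t, 0 <= t -> is_derive (fun s => f (x, s, t)) y (fy (x, y, t)).

(** [is_derive] with [locally t] restricted to [0,oo): the usual derivative at
    t > 0, the right derivative at t = 0. *)
Definition is_dt (f ft : R * R * R -> R) : Prop :=
  forall x y t, 0 <= t ->
    filterdiff (fun s => f (x, y, s)) (within (fun s => 0 <= s) (locally t))
      (fun h => scal h (ft (x, y, t))).

(** Class C^n up to the boundary t = 0. The partial derivatives are determined
    on the half-space, so the existentials introduce no choice there. *)
Fixpoint class_C (n : nat) (f : R * R * R -> R) : Prop :=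
  continuous_on half_space f /\
  match n with
  | O => True
  | S m =>
      exists fx fy ft : R * R * R -> R,
        (is_dx f fx /\ is_dy f fy /\ is_dt f ft) /\
        (class_C m fx /\ class_C m fy /\ class_C m ft)
  end.

Definition acoustic_solution (c : R) (p u v : R * R * R -> R) : Prop :=
  exists pt px py ut ux vt vy : R * R * R -> R,
    (is_dt p pt /\ is_dx p px /\ is_dy p py /\
     is_dt u ut /\ is_dx u ux /\ is_dt v vt /\ is_dy v vy) /\
    forall q, half_space q ->
      pt q + c * (ux q + vy q) = 0 /\
      ut q + c * px q = 0 /\
      vt q + c * py q = 0.

Definition Qpt (x y t r theta : R) : R * R * R :=
  (x + r * cos theta, y + r * sin theta, t).

(** e(h) = O(h^n) as h -> 0+. *)
Definition is_bigO_pow (n : nat) (e : R -> R) : Prop :=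
  exists K : R, at_right 0 (fun h => Rabs (e h) <= K * h ^ n).

(* Main.v *)
Require Import Defs.
From Stdlib Require Import Reals Lra.
From Coquelicot Require Import Coquelicot.
Open Scope R_scope.

(** Both sides of each formula are expanded to second order about
    P' = (x, y, t), and the expansions agree.

    In time, the equations give u_t = -c p_x and
    (p_x)_t = (p_t)_x = -c (u_xx + v_yx), hence with r = c dt
      u(P) = u - r p_x + (r^2 / 2) (u_xx + v_yx) + O(dt^3)
    ([velocity_time_taylor]). The point t = 0 is on the boundary, so this is
    obtained by integrating derivative bounds from the right
    ([is_bigO_pow_primitive]); only derivatives at strictly positive times
    enter, and there the exchange of d/dt and d/dx is Schwarz's theorem.

    In space, a field on the circle of radius r is its quadratic Taylor
    polynomial plus an error O(r^3) uniform in the angle ([taylor_circle]).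
    Against a quadratic trigonometric weight this polynomial integrates to a
    combination of the moments of the circle of degree at most 4
    ([circle_integral_expansion]). Odd moments vanish, and the three weights in
    the formula select exactly: -cos on p gives -pi r p_x, 2 cos^2 - 1/2 on u
    gives pi (u + (r^2 / 2) u_xx), and 2 sin cos on v gives
    pi (r^2 / 2) v_xy. Division by pi gives the expansion of u(P).

    The remaining bracket is itself O(dt^3): the mean of f over a circle of
    radius R is f + (R^2 / 4) (f_xx + f_yy) + O(R^3), and the combination
    (4 mean_{R/2} - mean_R) / 3 cancels the quadratic term
    ([mean_correction]).

    The formula for v follows in the same way, its expansion in time being that
    of u after the exchange of the coordinates x and y. *)

(** * Calculus of O(h^n) *)

Lemma is_bigO_pow_ext n e1 e2 :
  (forall h, e1 h = e2 h) -> is_bigO_pow n e1 -> is_bigO_pow n e2.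
Proof.
  intros E [K H]; exists K.
  revert H; apply filter_imp; intros h; now rewrite E.
Qed.

Lemma is_bigO_pow_plus n e1 e2 :
  is_bigO_pow n e1 -> is_bigO_pow n e2 -> is_bigO_pow n (fun h => e1 h + e2 h).
Proof.
  intros [K1 H1] [K2 H2]; exists (K1 + K2).
  generalize (filter_and _ _ H1 H2); apply filter_imp; intros h [h1 h2].
  generalize (Rabs_triang (e1 h) (e2 h)); lra.
Qed.

Lemma is_bigO_pow_scal n k e :
  is_bigO_pow n e -> is_bigO_pow n (fun h => k * e h).
Proof.
  intros [K H]; exists (Rabs k * K).
  revert H; apply filter_imp; intros h hh.
  rewrite Rabs_mult, Rmult_assoc.
  apply Rmult_le_compat_l; [apply Rabs_pos | exact hh].
Qed.

(** The two-sided hypothesis makes k = 0 admissible, where k * h stays at 0 and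
    a bound valid only for positive radii would say nothing. *)
Lemma is_bigO_pow_dilate n k e :
  (exists K, locally 0 (fun r => Rabs (e r) <= K * Rabs r ^ n)) ->
  is_bigO_pow n (fun h => e (k * h)).
Proof.
  intros [K H]; exists (K * Rabs k ^ n).
  assert (L : filterlim (fun h => k * h) (locally 0) (locally 0)).
  { pattern 0 at 2; replace 0 with (k * 0) by ring.
    apply (continuous_mult (fun _ => k) (fun h => h));
      [apply continuous_const | apply continuous_id]. }
  generalize (L _ H); unfold filtermap, at_right, within.
  apply filter_imp; intros h hh h0.
  rewrite Rabs_mult, (Rabs_pos_eq h), Rpow_mult_distr in hh by lra.
  lra.
Qed.

(** The mean value theorem on the interval from a to s, followed by a -> 0+.
    This one-sided form applies when 0 is a boundary point of the domain. *)
Lemma is_bigO_pow_primitive n e e' :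
  filterlim e (at_right 0) (locally 0) ->
  (forall s, 0 < s -> is_derive e s (e' s)) ->
  is_bigO_pow n e' -> is_bigO_pow (S n) e.
Proof.
  intros L D [K [d H]]; exists (Rabs K); exists d; intros s Bs s0.
  apply le_epsilon; intros eps Heps.
  destruct (proj1 (filterlim_locally e 0) L (mkposreal eps Heps)) as [d' H'].
  (* A point a between 0 and s so close to 0 that |e a| < eps. *)
  set (a := Rmin s d' / 2).
  assert (Ha : 0 < a < s /\ a < d').
  { unfold a; generalize (cond_pos d') (Rmin_l s d') (Rmin_r s d').
    intros; assert (0 < Rmin s d') by now apply Rmin_glb_lt.
    lra. }
  assert (Ea : Rabs (e a) < eps).
  { assert (B : ball 0 eps (e a)).
    { apply H'; [ | lra].
      change (Rabs (a - 0) < d'); rewrite Rminus_0_r, Rabs_pos_eq; lra. }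
    change (Rabs (e a - 0) < eps) in B; now rewrite Rminus_0_r in B. }
  destruct (MVT_gen e a s e') as [xi [Hxi E]].
  - rewrite Rmin_left, Rmax_right by lra; intros z Hz; apply D; lra.
  - rewrite Rmin_left, Rmax_right by lra; intros z Hz.
    apply continuity_pt_filterlim, (ex_derive_continuous e).
    exists (e' z); apply D; lra.
  - rewrite Rmin_left, Rmax_right in Hxi by lra.
    assert (B : Rabs (e' xi) <= Rabs K * s ^ n).
    { apply Rle_trans with (K * xi ^ n).
      - apply H; [ | lra].
        change (Rabs (s - 0) < d) in Bs; change (Rabs (xi - 0) < d).
        rewrite Rminus_0_r, Rabs_pos_eq in * by lra; lra.
      - apply Rle_trans with (Rabs K * xi ^ n).
        + apply Rmult_le_compat_r; [apply pow_le; lra | apply Rle_abs].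
        + apply Rmult_le_compat_l; [apply Rabs_pos | apply pow_incr; lra]. }
    replace (e s) with (e a + e' xi * (s - a)) by lra.
    apply Rle_trans with (Rabs (e a) + Rabs (e' xi) * (s - a)).
    { eapply Rle_trans; [apply Rabs_triang | ].
      rewrite Rabs_mult, (Rabs_pos_eq (s - a)) by lra; lra. }
    assert (Rabs (e' xi) * (s - a) <= (Rabs K * s ^ n) * s).
    { apply Rmult_le_compat; try lra; apply Rabs_pos. }
    simpl; lra.
Qed.

(** * Fields on the half-space *)

Lemma filterlim_triple {T} (F : (T -> Prop) -> Prop) {FF : Filter F}
  (a b s : T -> R) (x y t : R) :
  filterlim a F (locally x) -> filterlim b F (locally y) ->
  filterlim s F (locally t) ->
  filterlim (fun z => (a z, b z, s z)) F (locally (x, y, t)).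
Proof.
  intros Ha Hb Hs; apply filterlim_locally; intros eps.
  generalize (filter_and _ _ (proj1 (filterlim_locally a x) Ha eps)
    (filter_and _ _ (proj1 (filterlim_locally b y) Hb eps)
                    (proj1 (filterlim_locally s t) Hs eps))).
  apply filter_imp; intros z [h1 [h2 h3]]; repeat split; assumption.
Qed.

(** Continuity of a field on the half-space along a path (a, b, s) that stays in
    it; slices at fixed time, circles and time segments are all such paths. *)
Lemma filterlim_half_space {T} (F : (T -> Prop) -> Prop) {FF : Filter F}
  (f : R * R * R -> R) (a b s : T -> R) (x y t : R) :
  continuous_on half_space f -> 0 <= t ->
  filterlim a F (locally x) -> filterlim b F (locally y) ->
  filterlim s F (locally t) -> F (fun z => 0 <= s z) ->
  filterlim (fun z => f (a z, b z, s z)) F (locally (f (x, y, t))).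
Proof.
  intros Hf Ht Ha Hb Hs H0.
  apply (filterlim_comp _ _ _ (fun z => (a z, b z, s z)) f F
           (within half_space (locally (x, y, t)))).
  - intros P HP.
    assert (H1 : F (fun z => half_space (a z, b z, s z) -> P (a z, b z, s z)))
      by exact (filterlim_triple F a b s x y t Ha Hb Hs _ HP).
    generalize (filter_and _ _ H0 H1); unfold filtermap.
    apply filter_imp; intros z [h1 h2]; exact (h2 h1).
  - exact (Hf (x, y, t) Ht).
Qed.

Lemma class_C_continuous n f : class_C n f -> continuous_on half_space f.
Proof. destruct n; intros [H _]; exact H. Qed.

Lemma continuity_2d_slice f x y t :
  continuous_on half_space f -> 0 <= t ->
  continuity_2d_pt (fun a b => f (a, b, t)) x y.
Proof.
  intros Hf Ht; apply continuity_2d_pt_filterlim.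
  apply (filterlim_half_space (locally (x, y)) f fst snd (fun _ => t)); trivial.
  - apply continuous_fst.
  - apply continuous_snd.
  - apply filterlim_const.
  - now apply filter_forall.
Qed.

(** For t > 0 the constraint s >= 0 holds near t, so the one-sided notion is the
    ordinary derivative. *)
Lemma is_dt_positive_time f ft x y t :
  is_dt f ft -> 0 < t -> is_derive (fun s => f (x, y, s)) t (ft (x, y, t)).
Proof.
  intros H Ht; destruct (H x y t (Rlt_le _ _ Ht)) as [L D].
  split; [exact L | ].
  intros z Hz eps.
  assert (Hz' : is_filter_lim (within (fun s => 0 <= s) (locally t)) z).
  { intros P HP; unfold within.
    generalize (Hz P HP); apply filter_imp; auto. }
  generalize (D z Hz' eps) (open_gt 0 t Ht); unfold within; intros h1 h2.
  generalize (filter_and _ _ h1 h2).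
  apply filter_imp; intros s [g1 g2]; apply g1, Rlt_le, g2.
Qed.

Lemma is_dx_eq f g fx gx q :
  (forall q, half_space q -> f q = g q) -> is_dx f fx -> is_dx g gx ->
  half_space q -> fx q = gx q.
Proof.
  intros E Hf Hg Hq; destruct q as [[x y] t].
  rewrite <- (is_derive_unique _ _ (gx (x, y, t)) (Hg x y t Hq)).
  symmetry; apply is_derive_unique.
  apply is_derive_ext with (2 := Hf x y t Hq).
  intros s; apply E; exact Hq.
Qed.

Lemma is_dy_eq f g fy gy q :
  (forall q, half_space q -> f q = g q) -> is_dy f fy -> is_dy g gy ->
  half_space q -> fy q = gy q.
Proof.
  intros E Hf Hg Hq; destruct q as [[x y] t].
  rewrite <- (is_derive_unique _ _ (gy (x, y, t)) (Hg x y t Hq)).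
  symmetry; apply is_derive_unique.
  apply is_derive_ext with (2 := Hf x y t Hq).
  intros s; apply E; exact Hq.
Qed.

(** The values at negative times are irrelevant for class C^n. Together with the
    uniqueness of partial derivatives this transfers the regularity of the
    derivatives provided by [class_C] to any others. *)
Lemma class_C_ext n f g :
  (forall q, half_space q -> f q = g q) -> class_C n f -> class_C n g.
Proof.
  intros E H.
  assert (Cg : continuous_on half_space g).
  { intros q Hq; rewrite <- (E q Hq).
    apply (filterlim_within_ext (F := locally q) half_space f g).
    - intros z Hz; now apply E.
    - exact (class_C_continuous n f H q Hq). }
  destruct n as [ | n]; [now split | ].
  destruct H as [_ (fx & fy & ft & (Hx & Hy & Ht) & C)].
  split; [exact Cg | exists fx, fy, ft; split; [ | exact C]].
  split; [ | split].
  - intros x y t h; apply is_derive_ext with (2 := Hx x y t h).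
    intros s; apply E; exact h.
  - intros x y t h; apply is_derive_ext with (2 := Hy x y t h).
    intros s; apply E; exact h.
  - intros x y t h.
    apply filterdiff_ext_loc with (3 := Ht x y t h).
    + unfold within; apply filter_forall; intros s hs; exact (E (x, y, s) hs).
    (* A limit point z of the restricted neighbourhoods of t is nonnegative. *)
    + intros z Hz; apply (E (x, y, z)), Rnot_lt_le; intros h0.
      generalize (locally_singleton _ _ (Hz _ (open_lt 0 z h0))); lra.
Qed.

Lemma class_C_dx n f fx : class_C (S n) f -> is_dx f fx -> class_C n fx.
Proof.
  intros [_ (gx & gy & gt & (Hx & _ & _) & (C & _ & _))] H.
  apply (class_C_ext n gx); [ | exact C].
  intros q; now apply (is_dx_eq f f).
Qed.

Lemma class_C_dy n f fy : class_C (S n) f -> is_dy f fy -> class_C n fy.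
Proof.
  intros [_ (gx & gy & gt & (_ & Hy & _) & (_ & C & _))] H.
  apply (class_C_ext n gy); [ | exact C].
  intros q; now apply (is_dy_eq f f).
Qed.

(** The reflection x <-> y, under which the acoustic equations are invariant
    provided u and v are exchanged too. *)
Definition swap (f : R * R * R -> R) (q : R * R * R) : R :=
  f (snd (fst q), fst (fst q), snd q).

Lemma continuous_on_swap f :
  continuous_on half_space f -> continuous_on half_space (swap f).
Proof.
  intros Cf [[x y] t] h.
  apply (filterlim_half_space (within half_space (locally (x, y, t))) f
    (fun q => snd (fst q)) (fun q => fst (fst q)) snd y x t Cf h).
  4: unfold within; apply filter_forall; intros q hq; exact hq.
  all: apply (filterlim_filter_le_1 (G := within half_space (locally (x, y, t)))
    (F := locally (x, y, t)) _ (filter_le_within _)).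
  all: apply filterlim_locally; intros eps; exists eps;
    intros [[a b] s] [[h1 h2] h3]; assumption.
Qed.

Lemma class_C_swap n f : class_C n f -> class_C n (swap f).
Proof.
  revert f; induction n as [ | n IH]; intros f H.
  all: split; [exact (continuous_on_swap _ (class_C_continuous _ _ H)) | ].
  - exact I.
  - destruct H as [_ (fx & fy & ft & (Hx & Hy & Ht) & (Cx & Cy & Ct))].
    exists (swap fy), (swap fx), (swap ft).
    split; [ | now split; [ | split]; apply IH].
    split; [ | split]; intros x y t h;
      [exact (Hy y x t h) | exact (Hx y x t h) | exact (Ht y x t h)].
Qed.

(** * Taylor expansion on a circle *)

Lemma ex_diff_n_slice n f x y t :
  class_C n f -> 0 <= t -> ex_diff_n (fun a b => f (a, b, t)) n x y.
Proof.
  intros H Ht; revert f x y H; induction n as [ | n IH]; intros f x y H.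
  all: split; [apply continuity_2d_slice;
    [exact (class_C_continuous _ _ H) | exact Ht] | ].
  - exact I.
  - destruct H as [_ (fx & fy & ft & (Hx & Hy & _) & (Cx & Cy & _))].
    split; [ | split; [ | split]].
    + exists (fx (x, y, t)); now apply Hx.
    + exists (fy (x, y, t)); now apply Hy.
    + apply ex_diff_n_ext_loc with (2 := IH fx x y Cx).
      apply locally_2d_forall; intros a b; symmetry.
      now apply is_derive_unique, Hx.
    + apply ex_diff_n_ext_loc with (2 := IH fy x y Cy).
      apply locally_2d_forall; intros a b; symmetry.
      now apply is_derive_unique, Hy.
Qed.

Definition taylor2 (f0 fx fy fxx fxy fyy a b : R) : R :=
  f0 + fx * a + fy * b + (fxx * a ^ 2 + 2 * fxy * a * b + fyy * b ^ 2) / 2.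

(** The remainder of the two-dimensional Taylor formula is bounded by the cube of
    max(|r cos|, |r sin|) <= |r|, whence the uniformity in the angle. *)
Lemma taylor_circle f fx fy fxx fxy fyy x y t :
  class_C 3 f -> is_dx f fx -> is_dy f fy ->
  is_dx fx fxx -> is_dx fy fxy -> is_dy fy fyy -> 0 <= t ->
  exists K, locally 0 (fun r => forall theta,
    Rabs (f (Qpt x y t r theta) -
          taylor2 (f (x, y, t)) (fx (x, y, t)) (fy (x, y, t))
            (fxx (x, y, t)) (fxy (x, y, t)) (fyy (x, y, t))
            (r * cos theta) (r * sin theta)) <= K * Rabs r ^ 3).
Proof.
  intros Cf Hx Hy Hxx Hxy Hyy Ht.
  destruct (Taylor_Lagrange_2d (fun a b => f (a, b, t)) 2 x y) as [K [d H]].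
  { apply locally_2d_forall; intros a b; now apply ex_diff_n_slice. }
  assert (Dx : forall a b, Derive (fun s => f (s, b, t)) a = fx (a, b, t)).
  { intros a b; now apply is_derive_unique, Hx. }
  assert (Dy : forall a b, Derive (fun s => f (a, s, t)) b = fy (a, b, t)).
  { intros a b; now apply is_derive_unique, Hy. }
  assert (Dxx : Derive (fun s => fx (s, y, t)) x = fxx (x, y, t))
    by now apply is_derive_unique, Hxx.
  assert (Dxy : Derive (fun s => fy (s, y, t)) x = fxy (x, y, t))
    by now apply is_derive_unique, Hxy.
  assert (Dyy : Derive (fun s => fy (x, s, t)) y = fyy (x, y, t))
    by now apply is_derive_unique, Hyy.
  exists (Rabs K); exists d; intros r Hr theta.
  assert (Hr' : Rabs r < d).
  { change (Rabs (r - 0) < d) in Hr; now rewrite Rminus_0_r in Hr. }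
  assert (Bc : Rabs (r * cos theta) <= Rabs r).
  { rewrite Rabs_mult; rewrite <- (Rmult_1_r (Rabs r)) at 2.
    apply Rmult_le_compat_l; [apply Rabs_pos | ].
    apply Rabs_le, COS_bound. }
  assert (Bs : Rabs (r * sin theta) <= Rabs r).
  { rewrite Rabs_mult; rewrite <- (Rmult_1_r (Rabs r)) at 2.
    apply Rmult_le_compat_l; [apply Rabs_pos | ].
    apply Rabs_le, SIN_bound. }
  generalize (H (x + r * cos theta) (y + r * sin theta)).
  replace (x + r * cos theta - x) with (r * cos theta) by ring.
  replace (y + r * sin theta - y) with (r * sin theta) by ring.
  intros B; unfold Qpt.
  replace (taylor2 _ _ _ _ _ _ _ _)
    with (DL_pol 2 (fun a b => f (a, b, t)) x y (r * cos theta) (r * sin theta)).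
  - eapply Rle_trans; [apply B; lra | ].
    eapply Rle_trans;
      [apply Rmult_le_compat_r; [apply pow_le, Rle_trans with (2 := Rmax_l _ _), Rabs_pos | apply Rle_abs] | ].
    apply Rmult_le_compat_l; [apply Rabs_pos | ].
    apply pow_incr; split; [apply Rle_trans with (2 := Rmax_l _ _), Rabs_pos | ].
    now apply Rmax_lub.
  - unfold DL_pol, differential, partial_derive, taylor2, Binomial.C; simpl.
    rewrite Dx, Dy.
    rewrite (Derive_ext _ _ _ (fun a => Dx a y)).
    rewrite (Derive_ext _ _ _ (fun a => Dy a y)).
    rewrite (Derive_ext _ _ _ (fun b => Dy x b)).
    rewrite Dxx, Dxy, Dyy.
    field.
Qed.

(** * Integrals over a circle *)

(** All moments of the unit circle up to degree 4, by an explicit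
    antiderivative of each monomial. *)
Lemma is_RInt_trig_quartic
  a00 a10 a01 a20 a11 a02 a30 a21 a12 a03 a40 a31 a22 a13 a04 :
  is_RInt (fun s =>
    a00 + a10 * cos s + a01 * sin s
    + a20 * cos s ^ 2 + a11 * cos s * sin s + a02 * sin s ^ 2
    + a30 * cos s ^ 3 + a21 * cos s ^ 2 * sin s
    + a12 * cos s * sin s ^ 2 + a03 * sin s ^ 3
    + a40 * cos s ^ 4 + a31 * cos s ^ 3 * sin s + a22 * cos s ^ 2 * sin s ^ 2
    + a13 * cos s * sin s ^ 3 + a04 * sin s ^ 4) 0 (2 * PI)
    (PI * (2 * a00 + a20 + a02 + (3 * a40 + a22 + 3 * a04) / 4)).
Proof.
  set (A := fun s =>
    a00 * s + a10 * sin s - a01 * cos s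
    + a20 * ((s + sin s * cos s) / 2) + a11 * (sin s ^ 2 / 2)
    + a02 * ((s - sin s * cos s) / 2)
    + a30 * (sin s - sin s ^ 3 / 3) - a21 * (cos s ^ 3 / 3)
    + a12 * (sin s ^ 3 / 3) + a03 * (cos s ^ 3 / 3 - cos s)
    + a40 * (cos s ^ 3 * sin s / 4 + 3 / 8 * (s + sin s * cos s))
    - a31 * (cos s ^ 4 / 4)
    + a22 * (s / 8 - sin s * cos s * (cos s ^ 2 - sin s ^ 2) / 8)
    + a13 * (sin s ^ 4 / 4)
    + a04 * (3 / 8 * (s - sin s * cos s) - sin s ^ 3 * cos s / 4)).
  replace (PI * _) with (minus (A (2 * PI)) (A 0)).
  - apply (is_RInt_derive (V := R_CompleteNormedModule) A).
    + intros s _; unfold A; auto_derive; trivial.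
      assert (H : sin s ^ 2 = 1 - cos s ^ 2)
        by (generalize (sin2_cos2 s); unfold Rsqr; lra).
      (* The two sides agree modulo sin^2 = 1 - cos^2. *)
      simpl pred; field [H].
    + intros s _; apply (ex_derive_continuous (V := R_NormedModule)).
      auto_derive; trivial.
  - unfold minus, plus, opp, A; simpl.
    rewrite sin_2PI, cos_2PI, sin_0, cos_0; field.
Qed.

Definition trig_quadratic (w0 w10 w01 w20 w11 w02 s : R) : R :=
  w0 + w10 * cos s + w01 * sin s
  + w20 * cos s ^ 2 + w11 * cos s * sin s + w02 * sin s ^ 2.

Lemma trig_quadratic_bounded w0 w10 w01 w20 w11 w02 :
  exists B, forall s, Rabs (trig_quadratic w0 w10 w01 w20 w11 w02 s) <= B.
Proof.
  exists (Rabs w0 + Rabs w10 + Rabs w01 + Rabs w20 + Rabs w11 + Rabs w02).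
  intros s; unfold trig_quadratic.
  assert (Hc : Rabs (cos s) <= 1) by apply Rabs_le, COS_bound.
  assert (Hs : Rabs (sin s) <= 1) by apply Rabs_le, SIN_bound.
  assert (M : forall a b, Rabs b <= 1 -> Rabs (a * b) <= Rabs a).
  { intros a b H; rewrite Rabs_mult; rewrite <- (Rmult_1_r (Rabs a)) at 2.
    apply Rmult_le_compat_l; [apply Rabs_pos | exact H]. }
  assert (P : forall b, Rabs b <= 1 -> Rabs (b ^ 2) <= 1).
  { intros b H; replace (b ^ 2) with (b * b) by ring.
    apply Rle_trans with (1 := M b b H), H. }
  repeat (eapply Rle_trans; [apply Rabs_triang | apply Rplus_le_compat]).
  - apply Rle_refl.
  - now apply M.
  - now apply M.
  - now apply M, P.
  - now apply Rle_trans with (1 := M (w11 * cos s) _ Hs), M.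
  - now apply M, P.
Qed.

Lemma ex_RInt_circle f x y t r w0 w10 w01 w20 w11 w02 :
  continuous_on half_space f -> 0 <= t ->
  ex_RInt (fun s => f (Qpt x y t r s) * trig_quadratic w0 w10 w01 w20 w11 w02 s)
    0 (2 * PI).
Proof.
  intros Cf Ht.
  apply (ex_RInt_continuous (V := R_CompleteNormedModule)); intros s _.
  apply (continuous_mult (K := R_AbsRing) (fun s => f (Qpt x y t r s))).
  - apply (filterlim_half_space (locally s) f
      (fun s => x + r * cos s) (fun s => y + r * sin s) (fun _ => t)
      (x + r * cos s) (y + r * sin s) t Cf Ht).
    + apply (ex_derive_continuous (V := R_NormedModule) (fun s => x + r * cos s)).
      auto_derive; trivial.
    + apply (ex_derive_continuous (V := R_NormedModule) (fun s => y + r * sin s)).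
      auto_derive; trivial.
    + apply filterlim_const.
    + now apply filter_forall.
  - apply (ex_derive_continuous (V := R_NormedModule)).
    unfold trig_quadratic; auto_derive; trivial.
Qed.

(** The Taylor polynomial times the weight is a trigonometric polynomial of
    degree 4, integrated by its moments; the Taylor remainder times the bounded
    weight contributes O(r^3). *)
Lemma circle_integral_expansion f fx fy fxx fxy fyy x y t w0 w10 w01 w20 w11 w02 :
  class_C 3 f -> is_dx f fx -> is_dy f fy ->
  is_dx fx fxx -> is_dx fy fxy -> is_dy fy fyy -> 0 <= t ->
  exists K, locally 0 (fun r =>
    Rabs (RInt (fun s =>
            f (Qpt x y t r s) * trig_quadratic w0 w10 w01 w20 w11 w02 s)
            0 (2 * PI)
      - PI * ((2 * w0 + w20 + w02) * f (x, y, t)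
              + r * (w10 * fx (x, y, t) + w01 * fy (x, y, t))
              + r ^ 2 / 8 *
                ((4 * w0 + 3 * w20 + w02) * fxx (x, y, t)
                 + 2 * w11 * fxy (x, y, t)
                 + (4 * w0 + w20 + 3 * w02) * fyy (x, y, t))))
    <= K * Rabs r ^ 3).
Proof.
  intros Cf Hx Hy Hxx Hxy Hyy Ht.
  destruct (taylor_circle f fx fy fxx fxy fyy x y t) as [K H]; trivial.
  destruct (trig_quadratic_bounded w0 w10 w01 w20 w11 w02) as [B HB].
  set (w := trig_quadratic w0 w10 w01 w20 w11 w02) in *.
  exists (2 * PI * (K * B)); revert H; apply filter_imp; intros r H.
  set (V := PI * _).
  set (G := fun s => taylor2 (f (x, y, t)) (fx (x, y, t)) (fy (x, y, t))
    (fxx (x, y, t)) (fxy (x, y, t)) (fyy (x, y, t))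
    (r * cos s) (r * sin s)) in *.
  assert (IG : is_RInt (fun s => G s * w s) 0 (2 * PI) V).
  { unfold G, V; generalize (f (x, y, t)) (fx (x, y, t)) (fy (x, y, t))
      (fxx (x, y, t)) (fxy (x, y, t)) (fyy (x, y, t)).
    intros q qx qy qxx qxy qyy.
    (* The coefficients of the product of the Taylor polynomial and w. *)
    generalize (is_RInt_trig_quartic (w0 * q)
      (w10 * q + w0 * (r * qx))
      (w01 * q + w0 * (r * qy))
      (w20 * q + w10 * (r * qx) + w0 * (r ^ 2 / 2 * qxx))
      (w11 * q + w10 * (r * qy) + w01 * (r * qx) + w0 * (r ^ 2 * qxy))
      (w02 * q + w01 * (r * qy) + w0 * (r ^ 2 / 2 * qyy))
      (w20 * (r * qx) + w10 * (r ^ 2 / 2 * qxx))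
      (w20 * (r * qy) + w11 * (r * qx)
       + w10 * (r ^ 2 * qxy) + w01 * (r ^ 2 / 2 * qxx))
      (w02 * (r * qx) + w11 * (r * qy)
       + w01 * (r ^ 2 * qxy) + w10 * (r ^ 2 / 2 * qyy))
      (w02 * (r * qy) + w01 * (r ^ 2 / 2 * qyy))
      (w20 * (r ^ 2 / 2 * qxx))
      (w20 * (r ^ 2 * qxy) + w11 * (r ^ 2 / 2 * qxx))
      (w02 * (r ^ 2 / 2 * qxx) + w11 * (r ^ 2 * qxy) + w20 * (r ^ 2 / 2 * qyy))
      (w02 * (r ^ 2 * qxy) + w11 * (r ^ 2 / 2 * qyy))
      (w02 * (r ^ 2 / 2 * qyy))).
    match goal with |- is_RInt ?g _ _ ?I -> is_RInt ?h _ _ ?J =>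
      replace J with I by field;
      apply (is_RInt_ext g h)
    end.
    intros s _; unfold taylor2, w, trig_quadratic.
    match goal with |- ?a = ?b => change (@eq R a b) end; field. }
  assert (IF : is_RInt (fun s => f (Qpt x y t r s) * w s) 0 (2 * PI)
    (RInt (fun s => f (Qpt x y t r s) * w s) 0 (2 * PI))).
  { apply (RInt_correct (V := R_CompleteNormedModule)), ex_RInt_circle; trivial.
    exact (class_C_continuous _ _ Cf). }
  generalize (is_RInt_minus _ _ _ _ _ _ IF IG); intros ID.
  replace (2 * PI * (K * B) * Rabs r ^ 3)
    with ((2 * PI - 0) * (K * Rabs r ^ 3 * B)) by ring.
  apply (norm_RInt_le_const _ 0 (2 * PI) _ (K * Rabs r ^ 3 * B)) with (3 := ID).
  - generalize PI_RGT_0; lra.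
  - intros s _.
    change (Rabs (f (Qpt x y t r s) * w s - G s * w s) <= K * Rabs r ^ 3 * B).
    rewrite <- Rmult_minus_distr_r, Rabs_mult.
    apply Rmult_le_compat; try apply Rabs_pos; [apply H | apply HB].
Qed.

(** * Expansion in time *)

Lemma filterlim_time (f : R * R * R -> R) x y t :
  continuous_on half_space f -> 0 <= t ->
  filterlim (fun s => f (x, y, t + s)) (at_right 0) (locally (f (x, y, t))).
Proof.
  intros Cf Ht.
  apply (filterlim_half_space (at_right 0) f (fun _ => x) (fun _ => y)
    (fun s => t + s) x y t Cf Ht).
  - apply filterlim_const.
  - apply filterlim_const.
  - apply (filterlim_filter_le_1 (F := locally (0 : R)) _ (filter_le_within _)).
    pattern t at 2; replace t with (t + 0) by ring.
    apply (continuous_plus (V := R_NormedModule) (fun _ => t) (fun s => s));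
      [apply continuous_const | apply continuous_id].
  - exists (mkposreal 1 Rlt_0_1); intros s _ Hs; lra.
Qed.

Lemma filterlim_time_remainder (f : R * R * R -> R) (q : R -> R) x y t :
  continuous_on half_space f -> 0 <= t ->
  continuous q 0 -> q 0 = f (x, y, t) ->
  filterlim (fun s => f (x, y, t + s) - q s) (at_right 0) (locally 0).
Proof.
  intros Cf Ht Cq E.
  pattern 0 at 2; replace 0 with (f (x, y, t) - q 0) by (rewrite E; ring).
  apply (filterlim_comp_2 (H := locally (- q 0)) (fun s => f (x, y, t + s))
    (fun s => - q s) Rplus (filterlim_time f x y t Cf Ht)).
  - apply (filterlim_comp _ _ _ q Ropp (at_right 0) (locally (q 0))).
    + exact (filterlim_filter_le_1 (F := locally (0 : R)) _ (filter_le_within _) Cq).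
    + apply (filterlim_opp (q 0)).
  - apply (filterlim_plus (f (x, y, t)) (- q 0)).
Qed.

Lemma is_derive_shift (g : R -> R) (t s l : R) :
  is_derive g (t + s) l -> is_derive (fun z => g (t + z)) s l.
Proof.
  intros H; replace l with (scal 1 l) by exact (Rmult_1_l l).
  apply (is_derive_comp g (fun z => t + z)); [exact H | auto_derive; trivial].
Qed.

Lemma class_C_time_increment f x y t :
  class_C 1 f -> 0 <= t ->
  is_bigO_pow 1 (fun s => f (x, y, t + s) - f (x, y, t)).
Proof.
  intros [Cf (fx & fy & ft & (_ & _ & Dt) & (_ & _ & [Ct _]))] Ht.
  apply (is_bigO_pow_primitive 0 _ (fun s => ft (x, y, t + s))).
  - apply filterlim_time_remainder; trivial; apply continuous_const.
  - intros s Hs.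
    assert (H : is_derive (fun z => f (x, y, t + z)) s (ft (x, y, t + s))).
    { apply (is_derive_shift (fun z => f (x, y, z))).
      apply is_dt_positive_time; [exact Dt | lra]. }
    rewrite <- (Rminus_0_r (ft (x, y, t + s))).
    apply (is_derive_minus _ _ _ _ _ H (is_derive_const _ _)).
  - exists (Rabs (ft (x, y, t)) + 1).
    generalize (proj1 (filterlim_locally _ _) (filterlim_time ft x y t Ct Ht)
      (mkposreal 1 Rlt_0_1)).
    apply filter_imp; intros s Hs; simpl.
    change (Rabs (ft (x, y, t + s) - ft (x, y, t)) < 1) in Hs.
    generalize (Rabs_triang_inv (ft (x, y, t + s)) (ft (x, y, t))); lra.
Qed.

(** Schwarz's theorem in terms of given derivatives. They are required only for b
    in an open set, which is {b > 0} when b is the time. *)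
Lemma mixed_partials (D : R -> Prop) (F Fa Fb Fab Fba : R -> R -> R) a b :
  open D -> D b ->
  (forall a b, D b -> is_derive (fun z => F z b) a (Fa a b)) ->
  (forall a b, D b -> is_derive (fun z => F a z) b (Fb a b)) ->
  (forall a b, D b -> is_derive (fun z => Fa a z) b (Fab a b)) ->
  (forall a b, D b -> is_derive (fun z => Fb z b) a (Fba a b)) ->
  continuity_2d_pt Fab a b -> continuity_2d_pt Fba a b ->
  Fab a b = Fba a b.
Proof.
  intros OD Db Ha Hb Hab Hba Cab Cba.
  assert (Eab : forall a b, D b ->
    is_derive (fun z => Derive (fun s => F s z) a) b (Fab a b)).
  { intros a' b' Db'; apply is_derive_ext_loc with (2 := Hab a' b' Db').
    generalize (OD b' Db'); apply filter_imp; intros z Dz.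
    symmetry; now apply is_derive_unique, Ha. }
  assert (Eba : forall a b, D b ->
    is_derive (fun z => Derive (fun s => F z s) b) a (Fba a b)).
  { intros a' b' Db'; apply is_derive_ext with (2 := Hba a' b' Db').
    intros z; symmetry; now apply is_derive_unique, Hb. }
  assert (L : locally_2d (fun _ v => D v) a b).
  { destruct (OD b Db) as [d Hd]; exists d; intros u v _ Hv; now apply Hd. }
  rewrite <- (is_derive_unique _ _ _ (Eab a b Db)).
  rewrite <- (is_derive_unique _ _ _ (Eba a b Db)).
  symmetry; apply Schwarz.
  - revert L; apply locally_2d_impl, locally_2d_forall; intros u v Dv.
    repeat split; eexists; [now apply Ha | now apply Hb | now apply Eba | now apply Eab].
  - apply continuity_2d_pt_ext_loc with (2 := Cba).
    revert L; apply locally_2d_impl, locally_2d_forall; intros u v Dv.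
    symmetry; now apply is_derive_unique, Eba.
  - apply continuity_2d_pt_ext_loc with (2 := Cab).
    revert L; apply locally_2d_impl, locally_2d_forall; intros u v Dv.
    symmetry; now apply is_derive_unique, Eab.
Qed.

Lemma mixed_partials_xy n f fx fy fxy fyx q :
  class_C (S (S n)) f -> is_dx f fx -> is_dy f fy -> is_dx fy fxy -> is_dy fx fyx ->
  half_space q -> fyx q = fxy q.
Proof.
  intros Cf Hx Hy Hxy Hyx Hq; destruct q as [[x y] t].
  change (0 <= t) in Hq.
  apply (mixed_partials (fun _ => True) (fun a b => f (a, b, t))
    (fun a b => fx (a, b, t)) (fun a b => fy (a, b, t))
    (fun a b => fyx (a, b, t)) (fun a b => fxy (a, b, t)) x y);
    trivial; try (intros; now auto).
  - apply open_true.
  - apply continuity_2d_slice; [ | exact Hq].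
    apply (class_C_continuous n), (class_C_dy n fx); [ | exact Hyx].
    now apply (class_C_dx (S n) f).
  - apply continuity_2d_slice; [ | exact Hq].
    apply (class_C_continuous n), (class_C_dx n fy); [ | exact Hxy].
    now apply (class_C_dy (S n) f).
Qed.

(** The existence of the time derivative of px comes from the regularity of px,
    and its value from the known time derivative g of p. *)
Lemma dt_dx_commute n p px g gx x y t :
  class_C (S n) px -> is_dx p px -> is_dx g gx -> continuous_on half_space gx ->
  (forall x y t, 0 < t -> is_derive (fun s => p (x, y, s)) t (g (x, y, t))) ->
  0 < t -> is_derive (fun s => px (x, y, s)) t (gx (x, y, t)).
Proof.
  intros [_ (pxx & pyx & pxt & (_ & _ & Dt) & (_ & _ & Ct))] Hx Hg Cg Ht t0.
  apply class_C_continuous in Ct.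
  assert (C2 : forall f, continuous_on half_space f ->
    continuity_2d_pt (fun a s => f (a, y, s)) x t).
  { intros f Cf; apply continuity_2d_pt_filterlim.
    apply (filterlim_half_space (locally (x, t)) f fst (fun _ => y) snd x y t Cf).
    - lra.
    - apply continuous_fst.
    - apply filterlim_const.
    - apply continuous_snd.
    - destruct (open_gt 0 t t0) as [d Hd]; exists d; intros z [_ Hz].
      apply Rlt_le, Hd, Hz. }
  replace (gx (x, y, t)) with (pxt (x, y, t)).
  - now apply is_dt_positive_time.
  - apply (mixed_partials (fun s => 0 < s) (fun a s => p (a, y, s))
      (fun a s => px (a, y, s)) (fun a s => g (a, y, s))
      (fun a s => pxt (a, y, s)) (fun a s => gx (a, y, s)) x t (open_gt 0) t0).
    + intros a s hs; apply Hx; lra.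
    + intros a s hs; now apply Ht.
    + intros a s hs; now apply is_dt_positive_time.
    + intros a s hs; apply Hg; lra.
    + now apply C2.
    + now apply C2.
Qed.

(** The third-order bound is reached by integrating twice in time: the
    increments of u_xx and v_yx are O(s), so the first-order remainder of px is
    O(s^2), and the second-order remainder of u has -c times that one as its
    derivative. *)
Lemma velocity_time_taylor c p u v px ux uxx vy vyx x y t :
  class_C 3 p -> class_C 3 u -> class_C 3 v -> acoustic_solution c p u v ->
  is_dx p px -> is_dx u ux -> is_dx ux uxx -> is_dy v vy -> is_dx vy vyx ->
  0 <= t ->
  is_bigO_pow 3 (fun s => u (x, y, t + s) -
    (u (x, y, t) - c * s * px (x, y, t)
     + (c * s) ^ 2 / 2 * (uxx (x, y, t) + vyx (x, y, t)))).
Proof.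
  intros Cp Cu Cv (pt & px' & py' & ut & ux' & vt & vy' &
    (Hpt & Hpx' & _ & Hut & Hux' & _ & Hvy') & Heq) Hpx Hux Huxx Hvy Hvyx Ht.
  assert (Cuxx : class_C 1 uxx).
  { apply (class_C_dx 1 ux); [now apply (class_C_dx 2 u) | exact Huxx]. }
  assert (Cvyx : class_C 1 vyx).
  { apply (class_C_dx 1 vy); [now apply (class_C_dy 2 v) | exact Hvyx]. }
  assert (Du : forall x y t, 0 < t ->
    is_derive (fun s => u (x, y, s)) t (- c * px (x, y, t))).
  { intros x' y' t' h.
    destruct (Heq (x', y', t') (Rlt_le _ _ h)) as (_ & E & _).
    rewrite (is_dx_eq p p px px' (x', y', t')); trivial; [ | exact (Rlt_le _ _ h)].
    replace (- c * px' (x', y', t')) with (ut (x', y', t')) by lra.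
    now apply is_dt_positive_time. }
  assert (Dp : forall x y t, 0 < t ->
    is_derive (fun s => p (x, y, s)) t (- c * (ux (x, y, t) + vy (x, y, t)))).
  { intros x' y' t' h.
    destruct (Heq (x', y', t') (Rlt_le _ _ h)) as (E & _ & _).
    rewrite (is_dx_eq u u ux ux' (x', y', t')); trivial; [ | exact (Rlt_le _ _ h)].
    rewrite (is_dy_eq v v vy vy' (x', y', t')); trivial; [ | exact (Rlt_le _ _ h)].
    match goal with |- is_derive _ _ ?l => replace l with (pt (x', y', t')) by lra end.
    now apply is_dt_positive_time. }
  assert (Dpx : forall x y t, 0 < t ->
    is_derive (fun s => px (x, y, s)) t (- c * (uxx (x, y, t) + vyx (x, y, t)))).
  { intros x' y' t' h.
    apply (dt_dx_commute 1 p px (fun q => - c * (ux q + vy q))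
      (fun q => - c * (uxx q + vyx q)) x' y' t'); trivial.
    - now apply (class_C_dx 2 p).
    - intros a b s hs.
      apply (is_derive_scal (fun z => ux (z, b, s) + vy (z, b, s))).
      apply (is_derive_plus (V := R_NormedModule)); [now apply Huxx | now apply Hvyx].
    - intros q Hq.
      apply (filterlim_comp _ _ _ (fun q => uxx q + vyx q) (Rmult (- c))
        _ (locally (uxx q + vyx q))); [ |
        exact (filterlim_scal_r (V := R_NormedModule) (- c) (uxx q + vyx q))].
      apply (filterlim_comp_2 uxx vyx Rplus (class_C_continuous _ _ Cuxx q Hq)
        (class_C_continuous _ _ Cvyx q Hq)).
      apply (filterlim_plus (uxx q) (vyx q)). }
  set (a := px (x, y, t)); set (b := uxx (x, y, t) + vyx (x, y, t)).
  assert (O2 : is_bigO_pow 2 (fun s => px (x, y, t + s) - (a - c * s * b))).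
  { apply (is_bigO_pow_primitive 1 _ (fun s =>
      - c * ((uxx (x, y, t + s) - uxx (x, y, t))
             + (vyx (x, y, t + s) - vyx (x, y, t))))).
    - apply filterlim_time_remainder; trivial.
      + exact (class_C_continuous _ _ (class_C_dx 2 p px Cp Hpx)).
      + apply (ex_derive_continuous (V := R_NormedModule)); auto_derive; trivial.
      + unfold a; ring.
    - intros s Hs; assert (H := Dpx x y (t + s) ltac:(lra)).
      apply (is_derive_shift (fun z => px (x, y, z))) in H.
      replace (- c * _) with (- c * (uxx (x, y, t + s) + vyx (x, y, t + s)) - - c * b)
        by (unfold b; ring).
      apply (is_derive_minus _ _ _ _ _ H).
      auto_derive; [trivial | ring].
    - apply is_bigO_pow_scal, is_bigO_pow_plus; now apply class_C_time_increment. }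
  apply (is_bigO_pow_primitive 2 _
    (fun s => - c * (px (x, y, t + s) - (a - c * s * b)))).
  - apply filterlim_time_remainder; trivial.
    + exact (class_C_continuous _ _ Cu).
    + apply (ex_derive_continuous (V := R_NormedModule)); auto_derive; trivial.
    + unfold a; field.
  - intros s Hs; assert (H := Du x y (t + s) ltac:(lra)).
    apply (is_derive_shift (fun z => u (x, y, z))) in H.
    replace (- c * _) with (- c * px (x, y, t + s) - - c * (a - c * s * b)) by ring.
    apply (is_derive_minus _ _ _ _ _ H).
    auto_derive; [trivial | field].
  - now apply is_bigO_pow_scal.
Qed.

(** * Comparison of the expansions *)

Lemma class_C_spatial_derivatives n f :
  class_C (S n) f ->
  exists fx fy, is_dx f fx /\ is_dy f fy /\ class_C n fx /\ class_C n fy.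
Proof. intros [_ (fx & fy & ft & (Hx & Hy & _) & (Cx & Cy & _))]; now exists fx, fy. Qed.

Lemma acoustic_solution_swap c p u v :
  acoustic_solution c p u v -> acoustic_solution c (swap p) (swap v) (swap u).
Proof.
  intros (pt & px & py & ut & ux & vt & vy & (Hpt & Hpx & Hpy & Hut & Hux & Hvt & Hvy) & E).
  exists (swap pt), (swap py), (swap px), (swap vt), (swap vy), (swap ut), (swap ux).
  split.
  - exact (conj (fun x y => Hpt y x) (conj (fun x y => Hpy y x)
      (conj (fun x y => Hpx y x) (conj (fun x y => Hvt y x)
      (conj (fun x y => Hvy y x) (conj (fun x y => Hut y x)
      (fun x y => Hux y x))))))).
  - intros [[x y] t] h; destruct (E (y, x, t) h) as (E1 & E2 & E3).
    unfold swap; simpl; repeat split; lra.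
Qed.

Lemma RInt_plus3 (F f g h : R -> R) a b :
  (forall s, F s = f s + g s + h s) ->
  ex_RInt f a b -> ex_RInt g a b -> ex_RInt h a b ->
  RInt F a b = RInt f a b + RInt g a b + RInt h a b.
Proof.
  intros E If Ig Ih.
  rewrite (RInt_ext F (fun s => plus (plus (f s) (g s)) (h s))) by (intros; apply E).
  rewrite (RInt_plus (V := R_CompleteNormedModule) (fun s => plus (f s) (g s)) h);
    [ | now apply (ex_RInt_plus (V := R_NormedModule)) | exact Ih].
  now rewrite (RInt_plus (V := R_CompleteNormedModule) f g).
Qed.

(** Richardson extrapolation of the mean over circles of radii k h / 2 and k h:
    the weights 4/3 and -1/3 reproduce f and cancel its Laplacian. *)
Lemma mean_correction f x y t k :
  class_C 3 f -> 0 <= t ->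
  is_bigO_pow 3 (fun h => f (x, y, t)
    - 1 / 3 * (4 / (2 * PI) * RInt (fun s => f (Qpt x y t (k / 2 * h) s)) 0 (2 * PI)
               - 1 / (2 * PI) * RInt (fun s => f (Qpt x y t (k * h) s)) 0 (2 * PI))).
Proof.
  intros Cf Ht.
  destruct (class_C_spatial_derivatives 2 f Cf) as (fx & fy & Hx & Hy & Cx & Cy).
  destruct (class_C_spatial_derivatives 1 fx Cx) as (fxx & _ & Hxx & _).
  destruct (class_C_spatial_derivatives 1 fy Cy) as (fxy & fyy & Hxy & Hyy & _).
  generalize (circle_integral_expansion f fx fy fxx fxy fyy x y t 1 0 0 0 0 0
    Cf Hx Hy Hxx Hxy Hyy Ht); intros E.
  generalize (is_bigO_pow_plus 3 _ _
    (is_bigO_pow_scal 3 (- (2 / (3 * PI))) _ (is_bigO_pow_dilate 3 (k / 2) _ E))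
    (is_bigO_pow_scal 3 (1 / (6 * PI)) _ (is_bigO_pow_dilate 3 k _ E))).
  apply is_bigO_pow_ext; intros h.
  assert (W : forall r,
    RInt (fun s => f (Qpt x y t r s) * trig_quadratic 1 0 0 0 0 0 s) 0 (2 * PI) =
    RInt (fun s => f (Qpt x y t r s)) 0 (2 * PI)).
  { intros r; apply RInt_ext; intros s _; unfold trig_quadratic.
    match goal with |- ?a = ?b => change (@eq R a b) end; ring. }
  rewrite !W; field; apply PI_neq0.
Qed.

Theorem mainTheorem3 (c : R) (p u v : R * R * R -> R) (x y t nu : R)
  (hc : 0 < c)
  (hp : class_C 3 p) (hu : class_C 3 u) (hv : class_C 3 v)
  (hsol : acoustic_solution c p u v)
  (ht : 0 <= t) (hnu : 0 <= nu <= 1) :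
  is_bigO_pow 3 (fun dt =>
    u (x, y, t + dt) -
    (1 / PI * RInt (fun theta =>
         - p (Qpt x y t (c * dt) theta) * cos theta
         + u (Qpt x y t (c * dt) theta) * (2 * cos theta ^ 2 - 1 / 2)
         + 2 * v (Qpt x y t (c * dt) theta) * sin theta * cos theta) 0 (2 * PI)
     - (u (x, y, t)
        - 1 / 3 *
          (4 / (2 * PI) *
             RInt (fun theta => u (Qpt x y t (nu / 2 * c * dt) theta)) 0 (2 * PI)
           - 1 / (2 * PI) *
             RInt (fun theta => u (Qpt x y t (nu * c * dt) theta)) 0 (2 * PI)))))
  /\
  is_bigO_pow 3 (fun dt =>
    v (x, y, t + dt) -
    (1 / PI * RInt (fun theta =>
         - p (Qpt x y t (c * dt) theta) * sin theta
         + 2 * u (Qpt x y t (c * dt) theta) * sin theta * cos theta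
         + v (Qpt x y t (c * dt) theta) * (2 * sin theta ^ 2 - 1 / 2)) 0 (2 * PI)
     - (v (x, y, t)
        - 1 / 3 *
          (4 / (2 * PI) *
             RInt (fun theta => v (Qpt x y t (nu / 2 * c * dt) theta)) 0 (2 * PI)
           - 1 / (2 * PI) *
             RInt (fun theta => v (Qpt x y t (nu * c * dt) theta)) 0 (2 * PI))))).
Proof.
  destruct (class_C_spatial_derivatives 2 p hp) as (px & py & Hpx & Hpy & Cpx & Cpy).
  destruct (class_C_spatial_derivatives 1 px Cpx) as (pxx & _ & Hpxx & _).
  destruct (class_C_spatial_derivatives 1 py Cpy) as (pxy & pyy & Hpxy & Hpyy & _).
  destruct (class_C_spatial_derivatives 2 u hu) as (ux & uy & Hux & Huy & Cux & Cuy).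
  destruct (class_C_spatial_derivatives 1 ux Cux) as (uxx & uyx & Huxx & Huyx & _).
  destruct (class_C_spatial_derivatives 1 uy Cuy) as (uxy & uyy & Huxy & Huyy & _).
  destruct (class_C_spatial_derivatives 2 v hv) as (vx & vy & Hvx & Hvy & Cvx & Cvy).
  destruct (class_C_spatial_derivatives 1 vx Cvx) as (vxx & _ & Hvxx & _).
  destruct (class_C_spatial_derivatives 1 vy Cvy) as (vxy & vyy & Hvxy & Hvyy & _).
  assert (Ip := fun w0 w10 w01 w20 w11 w02 => is_bigO_pow_dilate 3 c _
    (circle_integral_expansion p px py pxx pxy pyy x y t w0 w10 w01 w20 w11 w02
      hp Hpx Hpy Hpxx Hpxy Hpyy ht)).
  assert (Iu := fun w0 w10 w01 w20 w11 w02 => is_bigO_pow_dilate 3 c _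
    (circle_integral_expansion u ux uy uxx uxy uyy x y t w0 w10 w01 w20 w11 w02
      hu Hux Huy Huxx Huxy Huyy ht)).
  assert (Iv := fun w0 w10 w01 w20 w11 w02 => is_bigO_pow_dilate 3 c _
    (circle_integral_expansion v vx vy vxx vxy vyy x y t w0 w10 w01 w20 w11 w02
      hv Hvx Hvy Hvxx Hvxy Hvyy ht)).
  assert (X : forall f, class_C 3 f -> forall r w0 w10 w01 w20 w11 w02,
    ex_RInt (fun s => f (Qpt x y t r s) * trig_quadratic w0 w10 w01 w20 w11 w02 s)
      0 (2 * PI)).
  { intros f Cf; intros; apply ex_RInt_circle; [exact (class_C_continuous _ _ Cf) | exact ht]. }
  split.
  (* The error is the remainder of u in time, minus the remainders of the three
     circle integrals divided by pi, plus the mean correction. *)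
  - generalize (is_bigO_pow_plus 3 _ _ (is_bigO_pow_plus 3 _ _
      (velocity_time_taylor c p u v px ux uxx vy vxy x y t
        hp hu hv hsol Hpx Hux Huxx Hvy Hvxy ht)
      (is_bigO_pow_scal 3 (- (1 / PI)) _ (is_bigO_pow_plus 3 _ _
        (is_bigO_pow_plus 3 _ _ (Ip 0 (-1) 0 0 0 0) (Iu (- (1 / 2)) 0 0 2 0 0))
        (Iv 0 0 0 0 2 0))))
      (mean_correction u x y t (nu * c) hu ht)).
    apply is_bigO_pow_ext; intros dt.
    replace (nu * c / 2 * dt) with (nu / 2 * c * dt) by field.
    match goal with |- _ = _ - (1 / PI * RInt ?F _ _ - _) =>
      rewrite (fun E => RInt_plus3 F _ _ _ _ _ E
      (X p hp (c * dt) 0 (-1) 0 0 0 0) (X u hu (c * dt) (- (1 / 2)) 0 0 2 0 0)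
      (X v hv (c * dt) 0 0 0 0 2 0))
    end; [ | intros s; unfold trig_quadratic; field].
    field; apply PI_neq0.
  - generalize (is_bigO_pow_plus 3 _ _ (is_bigO_pow_plus 3 _ _
      (velocity_time_taylor c (swap p) (swap v) (swap u) (swap py)
        (swap vy) (swap vyy) (swap ux) (swap uyx) y x t
        (class_C_swap _ _ hp) (class_C_swap _ _ hv) (class_C_swap _ _ hu)
        (acoustic_solution_swap _ _ _ _ hsol)
        (fun y x => Hpy x y) (fun y x => Hvy x y) (fun y x => Hvyy x y)
        (fun y x => Hux x y) (fun y x => Huyx x y) ht)
      (is_bigO_pow_scal 3 (- (1 / PI)) _ (is_bigO_pow_plus 3 _ _
        (is_bigO_pow_plus 3 _ _ (Ip 0 0 (-1) 0 0 0) (Iu 0 0 0 0 2 0))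
        (Iv (- (1 / 2)) 0 0 0 0 2))))
      (mean_correction v x y t (nu * c) hv ht)).
    apply is_bigO_pow_ext; intros dt; unfold swap; simpl fst; simpl snd.
    replace (nu * c / 2 * dt) with (nu / 2 * c * dt) by field.
    match goal with |- _ = _ - (1 / PI * RInt ?F _ _ - _) =>
      rewrite (fun E => RInt_plus3 F _ _ _ _ _ E
      (X p hp (c * dt) 0 0 (-1) 0 0 0) (X u hu (c * dt) 0 0 0 0 2 0)
      (X v hv (c * dt) (- (1 / 2)) 0 0 0 0 2))
    end; [ | intros s; unfold trig_quadratic; field].
    (* Time expansion yields d/dy of ux, the circle integral d/dx of uy. *)
    rewrite (mixed_partials_xy 1 u ux uy uxy uyx (x, y, t) hu Hux Huy Huxy Huyx ht).
    field; apply PI_neq0.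
Qed.
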